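(* Let $d$ and $q$ be positive integers. If $d>2$ or $q>2$, then the Hamming graph $H(d,q)$ is a pleat.
   Context: Let $S$ be a set with $q$ elements. The Hamming graph $H(d,q)$ has vertex set $\{(x_1,\ldots,x_d) : x_i\in S\}$, and two vertices are adjacent if and only if they differ in exactly one coordinate. For a vertex $v$ of a graph $G$, the neighborhood $N(v)$ is the set of all vertices adjacent to $v$. A graph $G$ is a pleat (or stiff) if there are no two distinct vertices $v,w$ of $G$ with $N(v)\subseteq N(w)$. *)

(* Defs.v *)
From mathcomp Require Import all_boot.
Set Implicit Arguments.
Unset Strict Implicit.
Unset Printing Implicit Defensive.

Record sgraph := SGraph {
  vertex :> finType;
  adj : rel vertex;
  adj_sym : symmetric adj;
  adj_irrefl : irreflexive adj }.

Definition neighborhood (G : sgraph) (v : G) : {set G} := [set w | adj v w].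

Definition pleat (G : sgraph) : Prop :=
  ~ exists v w : G, v <> w /\ neighborhood v \subset neighborhood w.

Definition hamming_adj (d : nat) (S : finType) : rel (d.-tuple S) :=
  fun x y => #|[set i : 'I_d | tnth x i != tnth y i]| == 1.

Lemma hamming_adj_sym (d : nat) (S : finType) : symmetric (@hamming_adj d S).
Proof.
move=> x y; rewrite /hamming_adj; congr (_ == _).
by apply: eq_card => i; rewrite !inE eq_sym.
Qed.

Lemma hamming_adj_irrefl (d : nat) (S : finType) :
  irreflexive (@hamming_adj d S).
Proof.
move=> x; rewrite /hamming_adj eq_card0 // => i.
by rewrite !inE eqxx.
Qed.

(* H(d, q), where q = #|S|. *)
Definition hamming (d : nat) (S : finType) : sgraph :=
  SGraph (@hamming_adj_sym d S) (@hamming_adj_irrefl d S).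

(* Main.v *)
Require Import Defs.
From mathcomp Require Import all_boot.

(** Let [D] be the set of coordinates at which two distinct vertices [v], [w]
    differ, and suppose that every neighbor of [v] is a neighbor of [w].
    Resetting one coordinate [j] of [v] to a new value [c] gives a neighbor of
    [v], hence one of [w], so that exactly one coordinate distinguishes it from
    [w].  But that number of coordinates is known ([diff_set_upd]): it is
    [#|D :\ j|] when [c] is the [j]-th coordinate of [w], and [#|j |: D|]
    otherwise.
    - Choosing [j] in [D] and [c] equal to the [j]-th coordinate of [w] gives
      [#|D| = 2].
    - If [S] has a third element, the same [j] with a [c] different from the
      coordinates of both [v] and [w] gives [#|D| = 1], a contradiction.
    - If there is a third coordinate, some [j] lies outside [D], and any change
      of [v] at [j] gives [#|D| + 1 = 1], again a contradiction.  A change is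
      possible because [v] and [w] already provide two elements of [S].  *)

Definition diff_set {d : nat} {S : finType} (x y : d.-tuple S) : {set 'I_d} :=
  [set i | tnth x i != tnth y i].

Definition upd {d : nat} {S : finType} (x : d.-tuple S) (j : 'I_d) (c : S) :
  d.-tuple S := [tuple if i == j then c else tnth x i | i < d].

Lemma diff_set_upd {d : nat} {S : finType} (x y : d.-tuple S) (j : 'I_d)
    (c : S) :
  diff_set (upd x j c) y =
  if c == tnth y j then diff_set x y :\ j else j |: diff_set x y.
Proof.
apply/setP=> i; case: ifP => cy; rewrite !inE tnth_mktuple;
  by have [->|] := eqVneq i j; rewrite ?cy.
Qed.

Lemma diff_setxx {d : nat} {S : finType} (x : d.-tuple S) :
  diff_set x x = set0.
Proof. by apply/setP=> i; rewrite !inE eqxx. Qed.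

Lemma upd_adj {d : nat} {S : finType} (x : d.-tuple S) (j : 'I_d) (c : S) :
  c != tnth x j -> hamming_adj x (upd x j c).
Proof.
move=> /negPf cx; rewrite hamming_adj_sym.
by rewrite /hamming_adj -/(diff_set _ _) diff_set_upd cx diff_setxx setU0 cards1.
Qed.

(** Supplies both a fresh value for a coordinate and a fresh coordinate. *)
Lemma card_lt_exists_notin {T : finType} (A : {set T}) :
  #|A| < #|T| -> exists x, x \notin A.
Proof.
move=> ltA; have /card_gt0P[x]: 0 < #|~: A|.
  by rewrite -(ltn_add2l #|A|) addn0 cardsC.
by rewrite inE; exists x.
Qed.

Theorem lemma3p1 (d q : nat) (S : finType) (hS : #|S| = q)
  (hd : 0 < d) (hq : 0 < q) (hdq : 2 < d \/ 2 < q) :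
  pleat (hamming d S).
Proof.
case=> [v [w [neq_vw /subsetP sub_vw]]]; rewrite /= in v w neq_vw sub_vw.
have [i vw_i] : exists i, tnth v i != tnth w i.
  apply/existsP; apply: contra_notT neq_vw => /existsPn eq_vw.
  by apply: eq_from_tnth => i; apply/eqP; rewrite -[_ == _]negbK eq_vw.
have Di : i \in diff_set v w by rewrite inE.
have near_w j c : c != tnth v j -> #|diff_set (upd v j c) w| = 1.
  move=> cv; have /sub_vw : upd v j c \in neighborhood (v : hamming d S).
    by rewrite inE; apply: upd_adj.
  by rewrite inE /= hamming_adj_sym => /eqP.
have card_D : #|diff_set v w| = 2.
  have := near_w i (tnth w i); rewrite eq_sym diff_set_upd eqxx => /(_ vw_i).
  by rewrite (cardsD1 i (diff_set v w)) Di => ->.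
case: hdq => [d_gt2 | q_gt2].
- have [j Dj] : exists j, j \notin diff_set v w.
    by apply: card_lt_exists_notin; rewrite card_D card_ord.
  have [c] : exists c, c \notin [set tnth v j].
    apply: card_lt_exists_notin.
    apply: leq_trans (max_card [set tnth v i; tnth w i]).
    by rewrite cards1 cards2 vw_i.
  have /eqP eq_vw_j : tnth v j == tnth w j by move: Dj; rewrite inE negbK.
  rewrite inE => cv; have := near_w j c cv.
  by rewrite diff_set_upd -eq_vw_j (negPf cv) cardsU1 Dj card_D.
- have [c] : exists c, c \notin [set tnth v i; tnth w i].
    by apply: card_lt_exists_notin; rewrite cards2 vw_i hS.
  rewrite !inE negb_or => /andP[cv cw]; have := near_w i c cv.
  by rewrite diff_set_upd (negPf cw) cardsU1 Di card_D.
Qed.
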